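(* Let $X, Y$ be reflexive strictly convex Banach spaces. Let $T,\delta T\in B(X,Y)$ with $\mathcal R(T)$ closed, and put $\bar T=T+\delta T$. Suppose that $$\gamma(T)^{-1}\|\delta T\|<1\quad\text{and}\quad \delta(\mathcal N(T),\mathcal N(\bar T))<\tfrac12\bigl(1-\gamma(T)^{-1}\|\delta T\|\bigr).$$ Then the Moore--Penrose metric generalized inverse $\bar T^M$ of $\bar T$ exists.
   Context: $B(X,Y)$ is the space of bounded linear operators from $X$ to $Y$; $\mathcal N(\cdot)$ and $\mathcal R(\cdot)$ denote null space and range. For a subset $G$ of a Banach space, $\mathrm{dist}(x,G)=\inf_{z\in G}\|x-z\|$. The reduced minimum module of $T\in B(X,Y)$ is $\gamma(T)=\inf\{\|Tx\| : x\in X,\ \mathrm{dist}(x,\mathcal N(T))=1\}$ (with $\gamma(T)=+\infty$ and $\gamma(T)^{-1}=0$ if $T=0$). For closed subspaces $M,N$ of a Banach space, $\delta(M,N)=\sup\{\mathrm{dist}(x,N): x\in M,\ \|x\|=1\}$ if $M\neq\{0\}$, and $\delta(M,N)=0$ if $M=\{0\}$. A subspace $G$ of a Banach space $Z$ is Chebyshev if each $z\in Z$ has exactly one nearest point in $G$, denoted $\pi_G(z)$; $\pi_G$ is the metric projector onto $G$. A bounded homogeneous operator $A:Y\to X$ is a map sending bounded sets to bounded sets with $A(\lambda y)=\lambda A(y)$ for all $y\in Y$, $\lambda\in\mathbb R$. For $S\in B(X,Y)$, existence of the Moore--Penrose metric generalized inverse $S^M$ means: $\mathcal N(S)$ and $\mathcal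 R(S)$ are Chebyshev subspaces of $X$ and $Y$, and there is a bounded homogeneous operator $S^M:Y\to X$ with $SS^MS=S$, $S^MSS^M=S^M$, $S^MS=I_X-\pi_{\mathcal N(S)}$, $SS^M=\pi_{\mathcal R(S)}$ (it is then unique). *)

(* Defs.v *)
From mathcomp Require Import all_boot all_order all_algebra.
From mathcomp Require Import all_classical all_reals all_analysis.

Set Implicit Arguments.
Unset Strict Implicit.
Unset Printing Implicit Defensive.

Import Order.TTheory GRing.Theory Num.Theory.
Import numFieldNormedType.Exports.

Local Open Scope classical_set_scope.
Local Open Scope ring_scope.

Definition nullspace (R : realType) (X Y : normedModType R) (T : X -> Y) :
  set X := [set x | T x = 0].

(** A linear map [T] satisfying [bounded_operator T] is an element of
    [B(X, Y)], and [opnorm T] is its norm. *)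
Definition bounded_operator (R : realType) (X Y : normedModType R)
  (T : X -> Y) : Prop :=
  exists M : R, forall x, `|T x| <= M * `|x|.

Definition opnorm (R : realType) (X Y : normedModType R) (T : X -> Y) : R :=
  sup [set `|T x| | x in [set x | `|x| <= 1]].

Definition dual (R : realType) (X : normedModType R) : set (X -> R^o) :=
  [set f | linear f /\ bounded_operator f].

(** Every bounded linear functional [Phi] on the normed space [dual X] is
    evaluation at a point of [X].  The dual is a set of functions, so [Phi] is
    a total function of which only the values on [dual X] matter. *)
Definition reflexive_space (R : realType) (X : normedModType R) : Prop :=
  forall Phi : (X -> R^o) -> R,
    (forall (a : R) (f g : X -> R^o), dual f -> dual g ->
      Phi (fun x => a * f x + g x) = a * Phi f + Phi g) ->
    (exists M : R, forall f : X -> R^o, dual f -> `|Phi f| <= M * opnorm f) ->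
    exists x : X, forall f : X -> R^o, dual f -> Phi f = f x.

Definition strictly_convex (R : realType) (X : normedModType R) : Prop :=
  forall x y : X, `|x| = 1 -> `|y| = 1 -> x != y -> `|x + y| < 2.

Definition dist (R : realType) (X : normedModType R) (x : X) (G : set X) : R :=
  inf [set `|x - z| | z in G].

(** If [T = 0], the set below is empty, its infimum is [+oo], and the inverse
    of [+oo] is [0]. *)
Definition reduced_min_modulus (R : realType) (X Y : normedModType R)
  (T : X -> Y) : \bar R :=
  ereal_inf [set (`|T x|)%:E | x in [set x | dist x (nullspace T) = 1]].

Definition gap (R : realType) (X : normedModType R) (M N : set X) : R :=
  if `[< M = [set 0] >] then 0
  else sup [set dist x N | x in [set x | M x /\ `|x| = 1]].

Definition nearest_point (R : realType) (Z : normedModType R) (G : set Z)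
  (z g : Z) : Prop :=
  G g /\ `|z - g| = dist z G.

Definition linear_subspace (R : realType) (Z : normedModType R) (G : set Z) :
  Prop :=
  G 0 /\ forall (a : R) (x y : Z), G x -> G y -> G (a *: x + y).

Definition chebyshev_subspace (R : realType) (Z : normedModType R)
  (G : set Z) : Prop :=
  linear_subspace G /\ forall z, exists! g, nearest_point G z g.

(** Meaningful only when [G] is Chebyshev; [xget] returns the default [0]
    if there is no nearest point. *)
Definition metric_projector (R : realType) (Z : normedModType R) (G : set Z)
  (z : Z) : Z :=
  xget 0 [set g | nearest_point G z g].

Definition bounded_homogeneous (R : realType) (Y X : normedModType R)
  (A : Y -> X) : Prop :=
  (forall B : set Y, bounded_set B -> bounded_set (A @` B)) /\
  (forall (a : R) (y : Y), A (a *: y) = a *: A y).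

Definition is_MP_metric_inverse (R : realType) (X Y : normedModType R)
  (S : X -> Y) (SM : Y -> X) : Prop :=
  [/\ bounded_homogeneous SM,
      forall x, S (SM (S x)) = S x,
      forall y, SM (S (SM y)) = SM y,
      forall x, SM (S x) = x - metric_projector (nullspace S) x &
      forall y, S (SM y) = metric_projector (range S) y].

Definition MP_metric_inverse_exists (R : realType) (X Y : normedModType R)
  (S : X -> Y) : Prop :=
  [/\ chebyshev_subspace (nullspace S), chebyshev_subspace (range S) &
      exists SM : Y -> X, is_MP_metric_inverse S SM].

(* Main.v *)
(** Write [S = T + dT].  For [v] in [N(S)] and [x' = x - v], splitting [x']
    along a point of [N(T)] gives
    [dist(x, N(S)) <= (1 + delta) dist(x', N(T)) + delta |x'|], while
    [|S x| >= gamma(T) dist(x', N(T)) - |dT| |x'|].  Minimizing over [v] yields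
    [|S x| >= c dist(x, N(S))] for some [c > 0], and then everything follows:
    [R(S)] is closed, the nearest points exist by reflexivity and are unique
    by strict convexity, and [S^M y = x - pi_{N(S)} x] for any [x] with
    [S x = pi_{R(S)} y]; its norm is [dist(x, N(S)) <= 2 |y| / c].
    That [gamma(T) > 0] is the open mapping theorem for [T].

    Reflexivity replaces all compactness and completeness arguments: a bounded
    filter on [X] has a point [x] such that [f x <= c] for each functional [f]
    with [f <= c] eventually (evaluate functionals along an ultrafilter), and by
    Hahn-Banach this [x] inherits norm bounds and membership in closed
    subspaces. *)
Require Import Defs.
From HB Require Import structures.
From mathcomp Require Import all_boot all_order all_algebra.
From mathcomp Require Import all_classical all_reals all_analysis.
From mathcomp Require Import lra.
Set Implicit Arguments.
Unset Strict Implicit.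
Unset Printing Implicit Defensive.

Import Order.TTheory GRing.Theory Num.Theory.
Import numFieldNormedType.Exports.

Local Open Scope classical_set_scope.
Local Open Scope ring_scope.

(** * Hahn-Banach theorem *)

(** Homogeneity is only an inequality; applying it to [a^-1] as well gives equality for [a > 0]. *)
Definition sublinear (R : realType) (V : lmodType R) (q : V -> R) : Prop :=
  (forall x y, q (x + y) <= q x + q y) /\
  (forall a x, 0 <= a -> q (a *: x) <= a * q x).

Lemma sublinear0 (R : realType) (V : lmodType R) (q : V -> R) :
  sublinear q -> q 0 = 0.
Proof.
move=> [qD qZ]; apply/eqP; rewrite eq_le; apply/andP; split.
  by have := qZ 0 0 (lexx _); rewrite scale0r mul0r.
by have := qD 0 0; rewrite addr0; lra.
Qed.

Lemma sublinearN (R : realType) (V : lmodType R) (q : V -> R) x :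
  sublinear q -> - q (- x) <= q x.
Proof.
move=> sq; have := sq.1 x (- x); rewrite subrr sublinear0//; lra.
Qed.

(** Bounds the chains in the Zorn argument. The pointwise infimum is finite because every member is
    at least [- p (- x)], and subadditive because the smaller of two members serves at both
    points. *)
Lemma sublinear_inf_chain (R : realType) (V : lmodType R) (p : V -> R)
    (A : set (V -> R)) :
  sublinear p -> A !=set0 ->
  (forall q, A q -> sublinear q /\ forall x, q x <= p x) ->
  (forall q r, A q -> A r -> (forall x, q x <= r x) \/ (forall x, r x <= q x)) ->
  exists2 m : V -> R, sublinear m & forall q, A q -> forall x, m x <= q x.
Proof.
move=> sp [q0 Aq0] Ap Atot.
pose m x := inf [set q x | q in A].
have mle q x : A q -> m x <= q x.
  move=> Aq; apply: ge_inf; last by exists q.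
  exists (- p (- x)) => _ [r /Ap[sr rp] <-].
  have := sublinearN x sr; have := rp (- x); lra.
have lem c x : (forall q, A q -> c <= q x) -> c <= m x.
  move=> cq; apply: lb_le_inf; first by exists (q0 x), q0.
  by move=> _ [q Aq <-]; exact: cq.
clearbody m; exists m => //; last by move=> q Aq x; exact: mle.
split=> [x y|a x a0].
  rewrite -lerBlDr; apply/lem => q Aq; rewrite lerBlDl -lerBlDr.
  apply/lem => r Ar; rewrite lerBlDl.
  have [qr|rq] := Atot _ _ Aq Ar.
    apply: (le_trans (mle q _ Aq)); have := (Ap _ Aq).1.1 x y.
    have := qr y; lra.
  apply: (le_trans (mle r _ Ar)); have := (Ap _ Ar).1.1 x y.
  have := rq x; lra.
move: a0; rewrite le_eqVlt => /predU1P[<-|a0].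
  rewrite scale0r mul0r; apply: (le_trans (mle q0 _ Aq0)).
  by rewrite (sublinear0 (Ap _ Aq0).1).
rewrite mulrC -ler_pdivrMr//; apply/lem => q Aq; rewrite ler_pdivrMr// mulrC.
by apply: (le_trans (mle q _ Aq)); apply: (Ap _ Aq).1.2; exact: ltW.
Qed.

(** In the infimum of [q (x + t *: y) - t * q y] over [t >= 0], the value [t = 0] gives
    [m x <= q x], and [t = 1] at [- y] gives [m (- y) <= - q y]. *)
Lemma sublinear_shift (R : realType) (V : lmodType R) (q : V -> R) (y : V) :
  sublinear q ->
  exists m : V -> R,
    [/\ sublinear m, forall x, m x <= q x & m (- y) <= - q y].
Proof.
move=> sq; have [qD qZ] := sq.
pose m x := inf [set q (x + t *: y) - t * q y | t in [set t | 0 <= t]].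
have mle t x : 0 <= t -> m x <= q (x + t *: y) - t * q y.
  move=> t0; apply: ge_inf; last by exists t.
  exists (- q (- x)) => _ [s /= s0 <-].
  have := qD (x + s *: y) (- x); rewrite addrAC subrr add0r.
  have := qD (s *: y) 0; rewrite addr0 (sublinear0 sq).
  have : s * q y <= q (s *: y).
    move: s0; rewrite le_eqVlt => /predU1P[<-|s0].
      by rewrite mul0r scale0r (sublinear0 sq).
    rewrite mulrC -ler_pdivlMr// mulrC.
    have := qZ s^-1 (s *: y); rewrite scalerA mulVf ?gt_eqF// scale1r.
    by apply; rewrite invr_ge0 ltW.
  lra.
have lem c x : (forall t, 0 <= t -> c <= q (x + t *: y) - t * q y) -> c <= m x.
  move=> ct; apply: lb_le_inf.
    by exists (q (x + 0 *: y) - 0 * q y), 0 => //=.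
  by move=> _ [t t0 <-]; exact: ct.
have mq x : m x <= q x.
  by have := mle 0 x (lexx _); rewrite scale0r addr0 mul0r subr0.
clearbody m; exists m; split=> //; last first.
  have := mle 1 (- y) ler01; rewrite scale1r addNr mul1r sublinear0//; lra.
split=> [x z|a x].
  rewrite -lerBlDr; apply/lem => t t0; rewrite lerBlDl -lerBlDr.
  apply/lem => s s0; rewrite lerBlDl.
  apply: (le_trans (mle (t + s) _ (addr_ge0 t0 s0))).
  have := qD (x + t *: y) (z + s *: y).
  by rewrite addrACA -scalerDl; lra.
rewrite le_eqVlt => /predU1P[<-|a0].
  by rewrite scale0r mul0r; apply: (le_trans (mq _)); rewrite sublinear0.
rewrite mulrC -ler_pdivrMr//; apply/lem => t t0; rewrite ler_pdivrMr// mulrC.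
apply: (le_trans (mle (a * t) _ (mulr_ge0 (ltW a0) t0))).
rewrite -scalerA -scalerDr mulrBr mulrA lerD2r.
by apply: qZ; exact: ltW.
Qed.

(* A minimal sublinear functional is odd, since otherwise [sublinear_shift]
   would lower it; an odd sublinear functional is linear. *)
Lemma hahn_banach_sublinear (R : realType) (V : lmodType R) (p : V -> R)
    (x0 : V) : sublinear p ->
  exists f : V -> R^o,
    [/\ linear f, forall x, f x <= p x & f x0 = p x0].
Proof.
(* Minimizing below [p'] instead of [p] settles the value at [x0]: since [p' (- x0) <= - p x0], an
   odd functional below [p'] is at least [p x0] there. *)
move=> /[dup] sp /(sublinear_shift x0)[p' [sp' p'p p'x0]].
pose T := {q : V -> R | sublinear q /\ forall x, q x <= p' x}.
(* The order is reversed, so that a maximal element for [rel] is a minimal functional. *)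
pose rel (q r : T) := `[< forall x, sval r x <= sval q x >].
have [|||A Atot|[q [sq qp']] qmin] := @Zorn T rel.
- by move=> q; apply/asboolP.
- move=> r s t /asboolP rs /asboolP st; apply/asboolP => x.
  exact: le_trans (rs x).
- move=> [r r'] [s s'] /asboolP rs /asboolP sr; apply: eq_exist.
  by apply/funext => x; apply/eqP; rewrite eq_le rs sr.
- have [[q Aq]|A0] := pselect (A !=set0); last first.
    exists (exist _ p' (conj sp' (fun x => lexx _))) => q Aq.
    by exfalso; apply: A0; exists q.
  have [|r [s As <-]|r s [r' Ar <-] [s' As <-]|m sm mle] :=
    @sublinear_inf_chain _ _ p' [set sval q | q in A] sp'.
  + by exists (sval q), q.
  + exact: (svalP s).
  + by case: (Atot _ _ Ar As) => /asboolP; [right|left].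
  have mp' : sublinear m /\ forall x, m x <= p' x.
    split=> // x; apply: le_trans ((svalP q).2 x).
    by apply: mle; exists q.
  exists (exist _ m mp') => r Ar; apply/asboolP => x /=.
  by apply: mle; exists r.
have qN y : q (- y) = - q y.
  have [m [sm mq my]] := sublinear_shift y sq.
  have mp' : sublinear m /\ forall x, m x <= p' x.
    by split=> // x; exact: le_trans (qp' x).
  have /(congr1 sval)/= qE := qmin (exist _ m mp') (asboolT mq).
  rewrite qE in my *; have := sublinearN y sm.
  have := mq (- y).
  have := mq y; lra.
have qZ a x : 0 <= a -> q (a *: x) = a * q x.
  move=> a0; apply/eqP; rewrite eq_le sq.2//=.
  by have := sq.2 a (- x) a0; rewrite scalerN !qN; lra.
have qZ' a x : q (a *: x) = a * q x.
  have [/qZ//|a0] := leP 0 a.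
  by rewrite -[a]opprK scaleNr qN qZ ?mulNr// oppr_ge0 ltW.
have qD x y : q (x + y) = q x + q y.
  apply/eqP; rewrite eq_le sq.1/=.
  by have := sq.1 (x + y) (- y); rewrite addrK qN; lra.
exists q; split=> [a x y|x|]; first by rewrite qD qZ'.
  exact: le_trans (p'p x).
apply/eqP; rewrite eq_le (le_trans (qp' _) (p'p _))/=.
by have := qp' (- x0); rewrite qN; move: p'x0; lra.
Qed.

(** * Distance to a subspace *)

Lemma dist_le (R : realType) (X : normedModType R) (G : set X) (x g : X) :
  G g -> dist x G <= `|x - g|.
Proof.
move=> Gg; apply: ge_inf; last by exists g.
by exists 0 => _ [z _ <-].
Qed.

Lemma dist_lt (R : realType) (X : normedModType R) (G : set X) (x : X) (c : R) :
  G !=set0 -> dist x G < c -> exists2 g, G g & `|x - g| < c.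
Proof.
move=> [g0 Gg0] dc.
have hi : has_inf [set `|x - z| | z in G].
  by split; [exists `|x - g0|, g0|exists 0 => _ [z _ <-]].
have c0 : 0 < c - dist x G by rewrite subr_gt0.
have [_ [g Gg <-]] := inf_adherent c0 hi.
by rewrite -/(dist x G) addrCA subrr addr0 => xgc; exists g.
Qed.

Lemma le_dist (R : realType) (X : normedModType R) (G : set X) (x : X) (c : R) :
  G !=set0 -> (forall g, G g -> c <= `|x - g|) -> c <= dist x G.
Proof.
move=> [g0 Gg0] cG; apply: lb_le_inf; first by exists `|x - g0|, g0.
by move=> _ [g Gg <-]; exact: cG.
Qed.

Lemma linear_subspaceD (R : realType) (X : normedModType R) (G : set X) x y :
  linear_subspace G -> G x -> G y -> G (x + y).
Proof. by move=> [_ GD] Gx Gy; rewrite -[x]scale1r; exact: GD. Qed.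

Lemma linear_subspaceZ (R : realType) (X : normedModType R) (G : set X) a x :
  linear_subspace G -> G x -> G (a *: x).
Proof. by move=> [G0 GD] Gx; rewrite -[_ *: _]addr0; exact: GD. Qed.

Lemma linear_subspaceB (R : realType) (X : normedModType R) (G : set X) x y :
  linear_subspace G -> G x -> G y -> G (x - y).
Proof.
move=> sG Gx Gy; apply: linear_subspaceD => //.
by rewrite -scaleN1r; exact: linear_subspaceZ.
Qed.

Lemma linear_subspace_neq0 (R : realType) (X : normedModType R) (G : set X) :
  linear_subspace G -> G !=set0.
Proof. by move=> [G0 _]; exists 0. Qed.
#[local] Hint Resolve linear_subspace_neq0 : core.

Lemma linear_subspace_set1 (R : realType) (X : normedModType R) :
  linear_subspace [set 0 : X].
Proof. by split=> // a x y -> ->; rewrite scaler0 addr0. Qed.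

Lemma dist_ge0 (R : realType) (X : normedModType R) (G : set X) (x : X) :
  0 <= dist x G.
Proof.
(* For empty [G] the infimum has the default value 0. *)
have [G0|/set0P/negP/negPn/eqP ->] := pselect (G !=set0); first exact: le_dist.
by rewrite /dist image_set0 inf0.
Qed.

Lemma dist_set1 (R : realType) (X : normedModType R) (x : X) :
  dist x [set 0] = `|x|.
Proof. by rewrite /dist image_set1 subr0 inf1. Qed.

Lemma dist_le_norm (R : realType) (X : normedModType R) (G : set X) (x : X) :
  linear_subspace G -> dist x G <= `|x|.
Proof. by move=> [G0 _]; have := dist_le x G0; rewrite subr0. Qed.

Lemma dist_mem (R : realType) (X : normedModType R) (G : set X) (x : X) :
  G x -> dist x G = 0.
Proof.
move=> Gx; apply/eqP; rewrite eq_le dist_ge0 andbT.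
by have := dist_le x Gx; rewrite subrr normr0.
Qed.

Lemma sublinear_dist (R : realType) (X : normedModType R) (G : set X) :
  linear_subspace G -> sublinear (fun x : X => dist x G).
Proof.
move=> sG; split=> [x y|a x].
  rewrite -lerBlDr; apply: le_dist => [|g Gg]; first exact: linear_subspace_neq0.
  rewrite lerBlDl -lerBlDr.
  apply: le_dist => [|h Gh]; first exact: linear_subspace_neq0.
  rewrite lerBlDl (le_trans (dist_le _ (linear_subspaceD sG Gg Gh)))//.
  by rewrite opprD addrACA ler_normD.
rewrite le_eqVlt => /predU1P[<-|a0].
  by rewrite scale0r mul0r dist_mem//; exact: sG.1.
rewrite mulrC -ler_pdivrMr//; apply: le_dist => [|g Gg].
  exact: linear_subspace_neq0.
rewrite ler_pdivrMr// mulrC -{2}(gtr0_norm a0) -normrZ scalerBr.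
by apply: dist_le; exact: linear_subspaceZ.
Qed.

Lemma distD (R : realType) (X : normedModType R) (G : set X) (x y : X) :
  linear_subspace G -> dist (x + y) G <= dist x G + dist y G.
Proof. by move=> sG; exact: (sublinear_dist sG).1. Qed.

Lemma distN (R : realType) (X : normedModType R) (G : set X) (x : X) :
  linear_subspace G -> dist (- x) G = dist x G.
Proof.
move=> sG.
have le_distN z : dist (- z) G <= dist z G.
  apply: le_dist => [|g Gg]; first exact: linear_subspace_neq0.
  rewrite -normrN opprB addrC -[g]opprK; apply: dist_le.
  by rewrite -sub0r; apply: linear_subspaceB => //; exact: sG.1.
by apply/eqP; rewrite eq_le le_distN -{1}[x]opprK le_distN.
Qed.

Lemma distZ (R : realType) (X : normedModType R) (G : set X) a (x : X) :
  linear_subspace G -> dist (a *: x) G = `|a| * dist x G.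
Proof.
move=> sG; have [_ dZ] := sublinear_dist sG.
have pZ b z : 0 < b -> dist (b *: z) G = b * dist z G.
  move=> b0; apply/eqP; rewrite eq_le dZ ?(ltW b0)//= mulrC -ler_pdivlMr//.
  have := dZ b^-1 (b *: z); rewrite scalerA mulVf ?gt_eqF// scale1r mulrC.
  by apply; rewrite invr_ge0 ltW.
have [a0|a0|<-] := ltgtP 0 a.
- by rewrite pZ// gtr0_norm.
- rewrite -[LHS]distN// -scaleNr pZ ?oppr_gt0// ltr0_norm//.
- by rewrite scale0r normr0 mul0r dist_mem//; exact: sG.1.
Qed.

Lemma distD_mem (R : realType) (X : normedModType R) (G : set X) (x g : X) :
  linear_subspace G -> G g -> dist (x + g) G = dist x G.
Proof.
move=> sG Gg; apply/eqP; rewrite eq_le; apply/andP; split.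
  by have := distD x g sG; rewrite (dist_mem Gg) addr0.
have := distD (x + g) (- g) sG; rewrite addrK distN// (dist_mem Gg); lra.
Qed.

(** * Bounded operators and norming functionals *)

Lemma bounded_operatorP (R : realType) (X Y : normedModType R) (S : X -> Y) :
  bounded_operator S -> exists2 M : R, 0 < M & forall x, `|S x| <= M * `|x|.
Proof.
move=> [M SM]; exists (`|M| + 1) => [|x]; first by rewrite ltr_wpDl.
apply: (le_trans (SM x)); rewrite ler_wpM2r// (le_trans (ler_norm M))//.
by rewrite lerDl.
Qed.

Lemma le_opnorm (R : realType) (X Y : normedModType R) (S : {linear X -> Y})
    (x : X) : bounded_operator S -> `|S x| <= opnorm S * `|x|.
Proof.
move=> /bounded_operatorP[M M0 SM].
have [->|x0] := eqVneq x 0; first by rewrite linear0 !normr0 mulr0.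
have nx : 0 < `|x| by rewrite normr_gt0.
rewrite -ler_pdivrMr//; apply: ub_le_sup.
  exists M => _ [z /= z1 <-]; apply: (le_trans (SM z)).
  by rewrite ler_piMr// ltW.
exists (`|x|^-1 *: x) => /=.
  by rewrite normrZ normfV normr_id mulVf ?gt_eqF.
by rewrite linearZ/= normrZ normfV normr_id mulrC.
Qed.

Lemma opnorm_ge0 (R : realType) (X Y : normedModType R) (S : {linear X -> Y}) :
  bounded_operator S -> 0 <= opnorm S.
Proof.
move=> /bounded_operatorP[M M0 SM]; apply: ub_le_sup.
  exists M => _ [z /= z1 <-]; apply: (le_trans (SM z)).
  by rewrite ler_piMr// ltW.
by exists 0 => /=; rewrite ?linear0 normr0.
Qed.

Lemma dual_linear (R : realType) (X : normedModType R) (f : X -> R^o) :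
  dual f -> exists g : {linear X -> R^o}, f = g.
Proof.
move=> [lf _].
pose g : {linear X -> R^o} := HB.pack f (GRing.isLinear.Build _ _ _ _ f lf).
by exists g.
Qed.

(** Hahn-Banach with the distance itself as dominating functional; the resulting [f] vanishes on [G]
    and has norm at most 1. For [G = [set 0]] it norms [x]. *)
Lemma hahn_banach_dist (R : realType) (X : normedModType R) (G : set X)
    (x : X) : linear_subspace G ->
  exists2 f : X -> R^o, dual f &
    (forall u, `|f u| <= dist u G) /\ f x = dist x G.
Proof.
move=> sG.
have [f [lf fG fx]] := hahn_banach_sublinear x (sublinear_dist sG).
pose g : {linear X -> R^o} := HB.pack f (GRing.isLinear.Build _ _ _ _ f lf).
have fd u : `|f u| <= dist u G.
  rewrite (@ler_norml R) fG andbT lerNl -distN// -[- f u](linearN g); exact: fG.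
exists f => //; split=> //; exists 1 => u; rewrite mul1r.
exact: le_trans (dist_le_norm _ _).
Qed.

Lemma hahn_banach_norm (R : realType) (X : normedModType R) (x : X) :
  exists2 f : X -> R^o, dual f & (forall u, `|f u| <= `|u|) /\ f x = `|x|.
Proof.
have [f df [fd fx]] := hahn_banach_dist x (linear_subspace_set1 X).
exists f => //; split=> [u|]; last by rewrite fx dist_set1.
by have := fd u; rewrite dist_set1.
Qed.

(** * Reflexivity and bounded filters *)

(* By Hahn-Banach, [x] lies in the closed convex hull of every member of [F].
   This is weaker than being a weak cluster point of [F], but enough for sets
   cut out by norm bounds and closed subspaces. *)
Definition convex_cluster (R : realType) (X : normedModType R)
    (F : set_system X) (x : X) : Prop :=
  forall f : X -> R^o, dual f -> forall c : R, F [set u | f u <= c] -> f x <= c.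

(** The image ultrafilter has a cluster point in a compact segment, and a cluster point of an
    ultrafilter is a limit. *)
Lemma ultra_bounded_cvg (R : realType) (T : Type) (U : set_system T)
    (f : T -> R) (K : R) :
  UltraFilter U -> U [set u | `|f u| <= K] -> cvg (f @ U).
Proof.
move=> uU UK.
have [|p [_ pc]] := @segment_compact R (- K) K (f @ U) _.
  have : U (f @^-1` `[- K, K]); last by [].
  by apply: filterS UK => u uK; rewrite /preimage/= in_itv/= -ler_norml.
apply/cvg_ex; exists p => A pA.
have [//|UnA] := in_ultra_setVsetC (f @^-1` A) uU.
by have [z []] := pc (~` A) A UnA pA.
Qed.

Lemma reflexive_convex_cluster (R : realType) (X : normedModType R)
    (F : set_system X) (M : R) :
  reflexive_space X -> ProperFilter F -> F [set u | `|u| <= M] ->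
  exists x, convex_cluster F x.
Proof.
move=> reflX PF FM.
have [U [uU FU]] := ultraFilterLemma PF.
have fM f : dual f -> U [set u | `|f u| <= opnorm f * M].
  move=> /[dup] /dual_linear[g ->] [_ bg].
  apply: filterS (FU _ FM) => u /= uM.
  by rewrite (le_trans (le_opnorm _ bg))// ler_wpM2l// opnorm_ge0.
have fcvg f : dual f -> cvg (f @ U).
  by move=> /fM; exact: ultra_bounded_cvg.
(* The limit along [U] is linear on the dual and bounded by [M], so reflexivity makes it the
   evaluation at some [x]. *)
have [a f g df dg||x xE] := reflX (fun f => lim (f @ U)).
- apply/cvg_lim => //; apply: cvgD; last exact: fcvg.
  by apply: cvgMl_tmp; exact: fcvg.
- exists M => f df; rewrite -lim_norm; last exact: fcvg.
  apply: limr_le; first exact: is_cvg_norm (fcvg _ df).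
  by rewrite mulrC; exact: fM.
- exists x => f df c Fc; rewrite -xE//; apply: limr_le; first exact: fcvg.
  exact: FU.
Qed.

Lemma dual_comp (R : realType) (X Y : normedModType R) (S : {linear X -> Y})
    (h : Y -> R^o) (a : R) :
  bounded_operator S -> dual h -> dual (fun u => a * h (S u) : R^o).
Proof.
move=> /bounded_operatorP[M M0 SM] /[dup] /dual_linear[g ->].
move=> [_ /bounded_operatorP[K K0 gK]]; split.
  by move=> b u v; rewrite linearP linearP/= mulrDr; congr (_ + _); exact: mulrCA.
exists (`|a| * (K * M)) => u; rewrite normrM -!mulrA ler_wpM2l//.
by rewrite (le_trans (gK _))// ler_wpM2l// ltW.
Qed.

Lemma bounded_operator_id (R : realType) (X : normedModType R) :
  bounded_operator (idfun : X -> X).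
Proof. by exists 1 => x; rewrite mul1r. Qed.

(** A functional norming [y - S x] confines the ball around [y] to a half-space, whose preimage
    under [S] is again a half-space and so contains [x]. Taking [S] to be [idfun] gives the balls of
    [X] itself. *)
Lemma convex_cluster_ball (R : realType) (X Y : normedModType R)
    (S : {linear X -> Y}) (F : set_system X) (x : X) (y : Y) (r : R) :
  bounded_operator S -> Filter F -> convex_cluster F x ->
  F [set u | `|y - S u| <= r] -> `|y - S x| <= r.
Proof.
move=> bS FF xF Fr; have [h dh [h1 hy]] := hahn_banach_norm (y - S x).
have [g gE] := dual_linear dh; rewrite gE in dh h1 hy.
have := xF _ (dual_comp (-1) bS dh) (r - g y).
have Fg : F [set u | -1 * g (S u) <= r - g y].
  apply: filterS Fr => u /=.
  have := h1 (y - S u); rewrite linearB/= ler_norml => /andP[_]; lra.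
by move=> /(_ Fg); rewrite -hy linearB/=; lra.
Qed.

(** The functional equal to [dist x G] at [x] vanishes on [G]; it is tested with [c = 0]. *)
Lemma convex_cluster_subspace (R : realType) (X : normedModType R)
    (G : set X) (F : set_system X) (x : X) :
  linear_subspace G -> Filter F -> convex_cluster F x -> F G -> dist x G = 0.
Proof.
move=> sG FF xF FG; have [f df [fG fx]] := hahn_banach_dist x sG.
apply/eqP; rewrite eq_le dist_ge0 andbT -fx; apply: xF => //.
apply: filterS FG => u Gu /=; apply: (le_trans (ler_norm _)).
by apply: (le_trans (fG u)); rewrite dist_mem.
Qed.

Lemma filter_from_gt0_proper (R : realType) (T : Type) (C : R -> set T) :
  (forall e, 0 < e -> C e !=set0) ->
  (forall d e, d <= e -> C d `<=` C e) ->
  ProperFilter (filter_from [set e | 0 < e] C).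
Proof.
move=> C0 Cle; apply: filter_from_proper => //.
apply: filter_from_filter; first by exists 1 => /=.
move=> d e /= d0 e0; exists (Num.min d e) => /=; first by rewrite lt_min d0.
by move=> u Cu; split; apply: Cle Cu; rewrite ge_min lexx ?orbT.
Qed.

(** * Nearest points in reflexive, strictly convex spaces *)

(** A cluster point of the near-minimizers is a minimizer. Closedness of [G] takes the form that
    points at distance 0 belong to [G]. *)
Lemma nearest_point_exists (R : realType) (X : normedModType R) (G : set X)
    (z : X) :
  reflexive_space X -> linear_subspace G -> (forall x, dist x G = 0 -> G x) ->
  exists g, nearest_point G z g.
Proof.
move=> reflX sG cG.
pose C e := [set g | G g /\ `|z - g| <= dist z G + e].
have PF : ProperFilter (filter_from [set e | 0 < e] C).
  apply: filter_from_gt0_proper => [e e0|d e de u [Gu zu]].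
    have [|g Gg zg] := @dist_lt _ _ G z (dist z G + e)
      (linear_subspace_neq0 sG).
      by rewrite ltrDl.
    by exists g; split=> //; exact: ltW.
  by split=> //; apply: (le_trans zu); rewrite lerD2l.
have [|g gF] := @reflexive_convex_cluster _ _ _
    (`|z| + (dist z G + 1)) reflX PF.
  exists 1 => //= g [_ zg] /=; rewrite -[g](subKr z).
  by rewrite (le_trans (ler_normB _ _))// lerD2l.
have Gg : G g.
  apply: cG; apply: (convex_cluster_subspace sG _ gF).
  by exists 1 => //= u [].
exists g; split=> //.
apply/eqP; rewrite eq_le dist_le// andbT; apply/ler_addgt0Pr => e e0.
apply: (@convex_cluster_ball _ _ _ idfun _ g z _ _ _ gF).
  exact: bounded_operator_id.
by exists e => //= u [].
Qed.

(** The midpoint of two distinct nearest points would be strictly nearer. Strict convexity concerns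
    unit vectors, so the differences are divided by the distance, and distance 0 is treated
    apart. *)
Lemma nearest_point_unique (R : realType) (X : normedModType R) (G : set X)
    (z g h : X) :
  strictly_convex X -> linear_subspace G ->
  nearest_point G z g -> nearest_point G z h -> g = h.
Proof.
move=> scX sG [Gg zg] [Gh zh].
have := dist_ge0 G z; rewrite le_eqVlt => /predU1P[d0|d0].
  move: zg zh; rewrite -d0 => /normr0P; rewrite subr_eq0 => /eqP <-.
  by move=> /normr0P; rewrite subr_eq0 => /eqP.
apply/eqP; apply: contraT => gh; set d := dist z G in zg zh d0 *.
have dV : 0 <= d^-1 by rewrite invr_ge0 ltW.
have := scX (d^-1 *: (z - g)) (d^-1 *: (z - h)).
rewrite !normrZ (ger0_norm dV) zg zh mulVf ?gt_eqF// => /(_ erefl erefl).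
have -> : d^-1 *: (z - g) != d^-1 *: (z - h).
  have d1 : d^-1 != 0 by rewrite invr_eq0 gt_eqF.
  by apply: contra_neq gh => /(scalerI d1)/addrI/oppr_inj.
move=> /(_ isT); rewrite -scalerDr normrZ ger0_norm//.
rewrite mulrC ltr_pdivrMr// => /lt_geF <-.
have Gm : G (2^-1 *: (g + h)).
  by apply: linear_subspaceZ => //; exact: linear_subspaceD.
rewrite mulrC -ler_pdivlMr// -/d; apply: (le_trans (dist_le z Gm)).
rewrite ler_pdivlMr// -{2}[2](@gtr0_norm R)// mulrC -normrZ.
rewrite scalerBr scalerA divff// scale1r opprD addrACA -opprD.
by rewrite scaler_nat mulr2n opprD.
Qed.

Lemma chebyshev_reflexive (R : realType) (X : normedModType R) (G : set X) :
  reflexive_space X -> strictly_convex X -> linear_subspace G ->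
  (forall x, dist x G = 0 -> G x) -> chebyshev_subspace G.
Proof.
move=> reflX scX sG cG; split=> // z.
have [g zg] := nearest_point_exists z reflX sG cG.
by exists g; split=> // h; exact: nearest_point_unique.
Qed.

(** A cluster point of the approximate solutions stays in the ball and solves the equation up to
    every [e]. *)
Lemma image_ball_closed (R : realType) (X Y : normedModType R)
    (S : {linear X -> Y}) (M : R) (y : Y) :
  reflexive_space X -> bounded_operator S ->
  (forall e, 0 < e -> exists2 x, `|x| <= M & `|y - S x| <= e) ->
  exists2 x, `|x| <= M & S x = y.
Proof.
move=> reflX bS yM.
pose C e := [set x | `|x| <= M /\ `|y - S x| <= e].
have PF : ProperFilter (filter_from [set e | 0 < e] C).
  apply: filter_from_gt0_proper => [e /yM[x xM yx]|d e de u [uM yu]].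
    by exists x.
  by split=> //; exact: le_trans de.
have FM : filter_from [set e | 0 < e] C [set u | `|u| <= M].
  by exists 1 => //= u [].
have [x xF] := reflexive_convex_cluster reflX PF FM.
exists x.
  rewrite -normrN -sub0r.
  apply: (@convex_cluster_ball _ _ _ idfun _ x 0 _ _ _ xF).
    exact: bounded_operator_id.
  by apply: filterS FM => u /=; rewrite sub0r normrN.
apply/esym/eqP; rewrite -subr_eq0 -normr_le0; apply/ler_addgt0Pr => e e0.
rewrite add0r; apply: (convex_cluster_ball bS _ xF).
by exists e => //= u [].
Qed.

(** * Baire and open mapping arguments *)

(** The condition on the radii puts each ball inside the preceding one. A cluster point replaces the
    limit of the centres, so the radii may stay away from 0. *)
Lemma nested_balls (R : realType) (Y : normedModType R) (G : set Y)
    (y : nat -> Y) (r : nat -> R) :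
  reflexive_space Y -> linear_subspace G -> (forall x, dist x G = 0 -> G x) ->
  (forall n, G (y n)) -> (forall n, 0 < r n) ->
  (forall n, `|y n - y n.+1| + r n.+1 <= r n) ->
  exists2 z, G z & forall n, `|y n - z| <= r n.
Proof.
move=> reflY sG cG Gy r0 yr.
pose C n := [set u | G u /\ `|y n - u| <= r n].
have CS n : C n.+1 `<=` C n.
  move=> u [Gu yu]; split=> //; rewrite -(subrKA (y n.+1)).
  by rewrite (le_trans (ler_normD _ _))// (le_trans _ (yr n))// lerD2l.
have Cle m n : (m <= n)%N -> C n `<=` C m.
  elim: n => [|n IH]; first by rewrite leqn0 => /eqP ->.
  rewrite leq_eqVlt => /predU1P[->//|]; rewrite ltnS => /IH.
  exact: subset_trans.
have PF : ProperFilter (filter_from setT C).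
  apply: filter_from_proper => [|n _].
    apply: filter_fromT_filter => [|m n]; first by exists 0%N.
    exists (maxn m n) => u Cu; split;
      apply: Cle Cu; rewrite ?leq_maxl ?leq_maxr//.
  by exists (y n); split=> //; rewrite subrr normr0 ltW.
have [|z zF] := @reflexive_convex_cluster _ _ _ (`|y 0%N| + r 0%N) reflY PF.
  exists 0%N => //= u [_ yu] /=; rewrite -[u](subKr (y 0%N)).
  by rewrite (le_trans (ler_normB _ _))// lerD2l.
exists z => [|n].
  apply: cG; apply: (convex_cluster_subspace sG _ zF).
  by exists 0%N => // u [].
apply: (@convex_cluster_ball _ _ _ idfun _ z _ _ _ _ zF).
  exact: bounded_operator_id.
by exists n => // u [].
Qed.

(** Baire's theorem inside [G]: if no [A n] contained a ball of [G], nested balls could avoid the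
    sets [A n] one after another, and their common point would lie in none of them. *)
Lemma relative_baire (R : realType) (Y : normedModType R) (G : set Y)
    (A : nat -> set Y) :
  reflexive_space Y -> linear_subspace G -> (forall x, dist x G = 0 -> G x) ->
  (forall n y, (forall e, 0 < e -> exists2 u, A n u & `|y - u| <= e) -> A n y) ->
  (forall y, G y -> exists n, A n y) ->
  exists n y r,
    [/\ G y, 0 < r & forall u, G u -> `|y - u| <= r -> A n u].
Proof.
move=> reflY sG cG cA GA; apply: contrapT => nA.
(* The validity of [p] is a premise inside the existential, so that [choice] yields a total step
   function. *)
have step n (p : Y * R) : exists q : Y * R, G p.1 -> 0 < p.2 ->
    [/\ G q.1, 0 < q.2, `|p.1 - q.1| + q.2 <= p.2 &
        forall u, `|q.1 - u| <= q.2 -> ~ A n u].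
  have [[Gp p0]|np] := pselect (G p.1 /\ 0 < p.2); last first.
    by exists p => Gp p0; exfalso; apply: np.
  have p20 : 0 < p.2 / 2 by rewrite divr_gt0.
  have [u [Gu pu nAu]] : exists u, [/\ G u, `|p.1 - u| <= p.2 / 2 & ~ A n u].
    apply: contrapT => nu; apply: nA; exists n, p.1, (p.2 / 2); split=> //.
    move=> u Gu pu.
    by apply: contrapT => nAu; apply: nu; exists u.
  have [e [e0 eA]] : exists e, 0 < e /\ forall v, `|u - v| <= e -> ~ A n v.
    apply: contrapT => ne; apply: nAu; apply: cA => e e0.
    apply: contrapT => ne'; apply: ne; exists e; split=> // v uv Av.
    by apply: ne'; exists v.
  exists (u, Num.min (p.2 / 2) e) => _ _ /=; split=> //.
  - by rewrite lt_min p20.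
  - have : Num.min (p.2 / 2) e <= p.2 / 2 by rewrite ge_min lexx.
    lra.
  - by move=> v; rewrite le_min => /andP[_]; exact: eA.
have [st stP] := choice (fun np : nat * (Y * R) => step np.1 np.2).
pose s := fix s n := if n is m.+1 then st (m, s m) else (0 : Y, 1 : R).
have sP n : G (s n).1 /\ 0 < (s n).2.
  elim: n => [|n [Gs s0]]; first by split=> //=; exact: sG.1.
  by have [] := stP (n, s n) Gs s0.
have sS n := stP (n, s n) (sP n).1 (sP n).2.
have [||n|z Gz zs] := @nested_balls _ _ G (fun n => (s n).1) (fun n => (s n).2)
  reflY sG cG.
- by move=> n; exact: (sP n).1.
- by move=> n; exact: (sP n).2.
- by have [] := sS n.
have [n Az] := GA _ Gz; have [_ _ _ nAz] := sS n.
(* It is the ball of index [n.+1] that was chosen to avoid [A n]. *)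
exact: nAz (zs n.+1) Az.
Qed.

Lemma closed_dist0 (R : realType) (Y : normedModType R) (G : set Y) (y : Y) :
  closed G -> G !=set0 -> dist y G = 0 -> G y.
Proof.
move=> cG G0 yG; apply: cG => B /nbhs_ballP[e /= e0 eB].
have [|g Gg yg] := @dist_lt _ _ G y e G0; first by rewrite yG.
by exists g; split=> //; apply: eB; rewrite -ball_normE.
Qed.

Lemma linear_subspace_nullspace (R : realType) (X Y : normedModType R)
    (S : {linear X -> Y}) : linear_subspace (nullspace S).
Proof.
split=> [|a x y Sx Sy]; rewrite /nullspace/= ?linear0//.
by rewrite linearP Sx Sy scaler0 addr0.
Qed.

Lemma linear_subspace_range (R : realType) (X Y : normedModType R)
    (S : {linear X -> Y}) : linear_subspace (range S).
Proof.
split=> [|a _ _ [x _ <-] [y _ <-]]; first by exists 0; rewrite ?linear0.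
by exists (a *: x + y); rewrite ?linearP.
Qed.

(* The open mapping theorem for operators with closed range. *)
Lemma closed_range_bounded_below (R : realType) (X Y : normedModType R)
    (T : {linear X -> Y}) :
  reflexive_space X -> reflexive_space Y -> bounded_operator T ->
  closed (range T) ->
  exists2 c : R, 0 < c & forall x, c * dist x (nullspace T) <= `|T x|.
Proof.
move=> reflX reflY bT cT.
have sN := linear_subspace_nullspace T.
have sR := linear_subspace_range T.
(* The images of the balls of radius [n] are closed and cover the range, so one of them contains a
   ball of the range. *)
have [|n y|_ [x _ <-]|n [y0 [r [Gy0 r0 rA]]]] :=
  @relative_baire _ _ (range T)
    (fun n => [set y | exists2 x, `|x| <= n%:R & T x = y]) reflY sR.
- by move=> y; apply: closed_dist0 => //; exact: linear_subspace_neq0.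
- move=> yA; apply: image_ball_closed => // e /yA[_ [x xn <-] yx].
  by exists x.
- by exists (Num.bound `|x|), x => //; rewrite ltW// archi_boundP.
(* Writing [y] as [(y0 + y) - y0] recentres that ball at 0, at the cost of doubling the bound on
   preimages. *)
have lift y : range T y -> `|y| <= r -> exists2 x, `|x| <= n%:R + n%:R & T x = y.
  move=> Gy yr; have [||x1 x1n Tx1] := rA (y0 + y).
  - exact: linear_subspaceD.
  - by rewrite opprD addrA subrr sub0r normrN.
  have [||x2 x2n Tx2] := rA y0 => //.
    by rewrite subrr normr0 ltW.
  exists (x1 - x2); first by rewrite (le_trans (ler_normB _ _))// lerD.
  by rewrite linearB/= Tx1 Tx2 addrC addKr.
have n0 : 0 < n%:R + n%:R + 1 :> R by rewrite ltr_wpDl// addr_ge0.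
(* Vectors of norm [r] lift with norm at most [2n]; the added 1 keeps the denominator positive when
   [n] is 0. *)
exists (r / (n%:R + n%:R + 1)) => [|x]; first by rewrite divr_gt0.
have [Tx0|Tx0] := eqVneq (T x) 0.
  by rewrite dist_mem// mulr0.
have Tx : 0 < `|T x| by rewrite normr_gt0.
pose t := r / `|T x|; have t0 : 0 < t by rewrite divr_gt0.
have [||x' x'n Tx'] := lift (t *: T x).
- by apply: linear_subspaceZ => //; exists x.
- by rewrite normrZ gtr0_norm// divfK// gt_eqF.
have : dist (t *: x) (nullspace T) <= n%:R + n%:R + 1.
  have Nx : nullspace T (t *: x - x').
    by rewrite /nullspace/= linearB/= linearZ/= Tx' subrr.
  apply: (le_trans (dist_le _ Nx)); rewrite subKr (le_trans x'n)//.
  by rewrite lerDl.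
rewrite distZ// gtr0_norm// /t mulrAC ler_pdivrMr// => tx.
by rewrite mulrAC ler_pdivrMr// [leRHS]mulrC.
Qed.

(** * Metric generalized inverses *)

Lemma nullspace_dist0 (R : realType) (X Y : normedModType R)
    (S : {linear X -> Y}) (x : X) :
  bounded_operator S -> dist x (nullspace S) = 0 -> nullspace S x.
Proof.
move=> /bounded_operatorP[M M0 SM] x0.
apply/eqP; rewrite -normr_le0 -(mulr0 M) -x0 mulrC -ler_pdivrMr//.
apply: le_dist => [|n Sn].
  by apply: linear_subspace_neq0; exact: linear_subspace_nullspace.
rewrite ler_pdivrMr// mulrC; apply: le_trans (SM _).
by rewrite linearB/= Sn subr0.
Qed.

(** Preimages of approximants of [y] can be corrected by null vectors so as to stay in one fixed
    ball, where [image_ball_closed] applies. *)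
Lemma bounded_below_range_closed (R : realType) (X Y : normedModType R)
    (S : {linear X -> Y}) (c : R) (y : Y) :
  reflexive_space X -> bounded_operator S -> 0 < c ->
  (forall x, c * dist x (nullspace S) <= `|S x|) ->
  dist y (range S) = 0 -> range S y.
Proof.
move=> reflX bS c0 cS y0.
(* Approximants within 1 of [y] have norm at most [|y| + 1], so their preimages lie within
   [(|y| + 1) / c] of the null space; the last 1 is slack for choosing a null vector. *)
have [|x _ <-] := @image_ball_closed _ _ _ S ((`|y| + 1) / c + 1) y reflX bS;
  last by exists x.
move=> e e0.
have [||_ [x _ <-] yx] := @dist_lt _ _ (range S) y (Num.min e 1).
- by apply: linear_subspace_neq0; exact: linear_subspace_range.
- by rewrite y0 lt_min e0 ltr01.
move: yx; rewrite lt_min => /andP[yxe yx1].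
have Sx : `|S x| <= `|y| + 1.
  by rewrite -[S x](subKr y) (le_trans (ler_normB _ _))// lerD2l ltW.
have [||n Sn xn] := @dist_lt _ _ (nullspace S) x ((`|y| + 1) / c + 1).
- by apply: linear_subspace_neq0; exact: linear_subspace_nullspace.
- apply: (@le_lt_trans _ _ ((`|y| + 1) / c)); last by rewrite ltrDl.
  by rewrite ler_pdivlMr// mulrC (le_trans (cS x)).
exists (x - n); first exact: ltW.
by rewrite linearB/= Sn subr0 ltW.
Qed.

(** Metric projectors need not be additive; this quasi-additivity over [G] is what replaces
    linearity. *)
Lemma nearest_pointD (R : realType) (X : normedModType R) (G : set X)
    (z g h : X) :
  linear_subspace G -> G h -> nearest_point G z g ->
  nearest_point G (z + h) (g + h).
Proof.
move=> sG Gh [Gg zg]; split; first exact: linear_subspaceD.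
by rewrite distD_mem// opprD addrACA subrr addr0.
Qed.

Lemma nearest_pointZ (R : realType) (X : normedModType R) (G : set X)
    (a : R) (z g : X) :
  linear_subspace G -> nearest_point G z g ->
  nearest_point G (a *: z) (a *: g).
Proof.
move=> sG [Gg zg]; split; first exact: linear_subspaceZ.
by rewrite distZ// -scalerBr normrZ zg.
Qed.

Lemma metric_projectorP (R : realType) (X : normedModType R) (G : set X)
    (z : X) : chebyshev_subspace G -> nearest_point G z (metric_projector G z).
Proof.
move=> [_ /(_ z)[g [zg _]]].
by have := @xgetPex _ 0 [set g | nearest_point G z g]; apply; exists g.
Qed.

Lemma metric_projector_eq (R : realType) (X : normedModType R) (G : set X)
    (z g : X) :
  chebyshev_subspace G -> nearest_point G z g -> metric_projector G z = g.
Proof.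
move=> cG zg; have [h [_ hu]] := cG.2 z.
by rewrite -(hu _ zg) -(hu _ (metric_projectorP z cG)).
Qed.

Lemma metric_projector_mem (R : realType) (X : normedModType R) (G : set X)
    (g : X) : chebyshev_subspace G -> G g -> metric_projector G g = g.
Proof.
move=> cG Gg; apply: metric_projector_eq => //; split=> //.
by rewrite subrr normr0 dist_mem.
Qed.

Lemma MP_metric_inverse_bounded_below (R : realType) (X Y : normedModType R)
    (S : {linear X -> Y}) (c : R) :
  chebyshev_subspace (nullspace S) -> chebyshev_subspace (range S) ->
  0 < c -> (forall x, c * dist x (nullspace S) <= `|S x|) ->
  MP_metric_inverse_exists S.
Proof.
move=> cN cR c0 cS; split=> //.
set N := nullspace S in cN cS *; set G := range S in cR *.
have sN : linear_subspace N by exact: linear_subspace_nullspace.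
have sG : linear_subspace G by exact: linear_subspace_range.
have piN z : nearest_point N z (metric_projector N z).
  exact: metric_projectorP.
have piG z : nearest_point G z (metric_projector G z).
  exact: metric_projectorP.
(* The element of least norm in the coset of [x] modulo [N]; it depends only on [S x], which is
   [q_eq]. All the identities below follow from this. *)
pose q x := x - metric_projector N x.
have Sq x : S (q x) = S x by rewrite /q linearB/= (piN x).1 subr0.
have q_eq x x' : S x = S x' -> q x = q x'.
  move=> xx'; rewrite /q -[in LHS](subrKC x' x).
  rewrite (metric_projector_eq cN (nearest_pointD sN _ (piN x'))).
    by rewrite opprD addrACA subrr addr0.
  by rewrite /N/nullspace/= linearB/= xx' subrr.
have qZ a x : q (a *: x) = a *: q x.
  by rewrite /q (metric_projector_eq cN (nearest_pointZ a sN (piN x))) scalerBr.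
have /choice[x xS] y : exists x : X, S x = metric_projector G y.
  by have [[x _ <-] _] := piG y; exists x.
exists (fun y => q (x y)); split.
- split=> [B [M [_ BM]]|a y].
    (* The norm of [q (x y)] is [dist (x y) N], at most [c^-1] times the norm of the projection of
       [y], which is at most twice that of [y]. *)
    exists (c^-1 * (2 * (`|M| + 1))); split; first exact: num_real.
    move=> K MK _ [y By <-]; apply: (le_trans _ (ltW MK)).
    have yM : `|y| <= `|M| + 1.
      by apply: BM By; rewrite (le_lt_trans (ler_norm M))// ltrDl.
    rewrite (piN (x y)).2 ler_pdivlMl// (le_trans (cS _))// xS.
    have [_ yG] := piG y.
    rewrite -[metric_projector G y](subKr y) (le_trans (ler_normB _ _))// yG.
    by have := dist_le_norm y sG; lra.
  rewrite -qZ; apply: q_eq; rewrite linearZ/= !xS.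
  by apply: metric_projector_eq => //; exact: nearest_pointZ.
- by move=> z; rewrite Sq xS metric_projector_mem//; exists z.
- move=> y; apply: q_eq; rewrite Sq !xS.
  by apply: metric_projector_mem => //; exact: (piG y).1.
- by move=> z; apply: q_eq; rewrite xS metric_projector_mem//; exists z.
- by move=> y; rewrite Sq xS.
Qed.

(** * Perturbation *)

Lemma gap_le (R : realType) (X : normedModType R) (M N : set X) (x : X) :
  linear_subspace M -> linear_subspace N -> M x ->
  dist x N <= gap M N * `|x|.
Proof.
move=> sM sN Mx.
have [->|x0] := eqVneq x 0; first by rewrite normr0 mulr0 dist_mem//; exact: sN.1.
have nx : 0 < `|x| by rewrite normr_gt0.
rewrite /gap asboolF; last by move=> M0; move: Mx x0; rewrite M0 => ->; rewrite eqxx.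
rewrite -ler_pdivrMr//; apply: ub_le_sup.
  exists 1 => _ [z [_ z1] <-]; rewrite -z1; exact: dist_le_norm.
exists (`|x|^-1 *: x); last by rewrite distZ// normfV normr_id mulrC.
split; first exact: linear_subspaceZ.
by rewrite normrZ normfV normr_id mulVf ?gt_eqF.
Qed.

Lemma gap_ge0 (R : realType) (X : normedModType R) (M N : set X) :
  0 <= gap M N.
Proof.
rewrite /gap; case: ifPn => // _; set A := [set dist x N | x in _].
(* If there is no supremum, [sup] has the default value 0. *)
have [[[_ [z zM _]] ubA]|/sup_out->//] := pselect (has_sup A).
by rewrite (le_trans (dist_ge0 N z))//; apply: ub_le_sup => //; exists z.
Qed.

Lemma reduced_min_modulus_le (R : realType) (X Y : normedModType R)
    (T : {linear X -> Y}) (x : X) : 0 < dist x (nullspace T) ->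
  (reduced_min_modulus T <= (`|T x| / dist x (nullspace T))%:E)%E.
Proof.
move=> x0; apply: ereal_inf_lbound.
have dV : 0 <= (dist x (nullspace T))^-1 by rewrite invr_ge0 ltW.
exists ((dist x (nullspace T))^-1 *: x) => /=.
  rewrite distZ; last exact: linear_subspace_nullspace.
  by rewrite ger0_norm// mulVf// gt_eqF.
by rewrite linearZ/= normrZ ger0_norm// mulrC.
Qed.

(* If [T = 0] the modulus is [+oo] and the conclusion holds for every real
   [g], because all the distances to [nullspace T] vanish. *)
Lemma reduced_min_modulus_bounded_below (R : realType) (X Y : normedModType R)
    (T : {linear X -> Y}) (g : R) (x : X) :
  (g%:E <= reduced_min_modulus T)%E -> g * dist x (nullspace T) <= `|T x|.
Proof.
move=> gT; have := dist_ge0 (nullspace T) x.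
rewrite le_eqVlt => /predU1P[<-|x0]; first by rewrite mulr0.
rewrite -ler_pdivlMr// -lee_fin; apply: (le_trans gT).
exact: reduced_min_modulus_le.
Qed.

Lemma le_reduced_min_modulus (R : realType) (X Y : normedModType R)
    (T : {linear X -> Y}) (c : R) :
  (forall x, c * dist x (nullspace T) <= `|T x|) ->
  (c%:E <= reduced_min_modulus T)%E.
Proof.
move=> cT; apply/ereal_infP => _ [x /= x1 <-].
by rewrite lee_fin; have := cT x; rewrite x1 mulr1.
Qed.

(** With [g] for the modulus, [d] for the norm of [dT] and [e] for the gap, [d < g * (1 - 2 * e)] is
    the smallness condition on the gap, cleared of denominators. *)
Lemma perturbation_bounded_below (R : realType) (X Y : normedModType R)
    (T dT S : {linear X -> Y}) (g d e : R) :
  (forall x, S x = T x + dT x) ->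
  (forall x, g * dist x (nullspace T) <= `|T x|) ->
  (forall x, `|dT x| <= d * `|x|) ->
  (forall u, nullspace T u -> dist u (nullspace S) <= e * `|u|) ->
  0 < g -> 0 <= d -> 0 <= e -> d < g * (1 - 2 * e) ->
  exists2 c : R, 0 < c & forall x, c * dist x (nullspace S) <= `|S x|.
Proof.
move=> SE gT dTd eS g0 d0 e0 dg.
have sS := linear_subspace_nullspace S.
have sT := linear_subspace_nullspace T.
(* For [u] in the null space of [T], the distance is at most [|x - u| + e |u|], and
   [|u| <= |x| + |x - u|]; then minimize over [u]. *)
have distS x : dist x (nullspace S) <=
    (1 + e) * dist x (nullspace T) + e * `|x|.
  rewrite -lerBlDr [leRHS]mulrC -ler_pdivrMr; last lra.
  apply: le_dist => [|u Tu]; first exact: linear_subspace_neq0.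
  rewrite ler_pdivrMr; last lra.
  have := distD (x - u) u sS; rewrite subrK.
  have := dist_le_norm (x - u) sS; have := eS _ Tu.
  have : e * `|u| <= e * (`|x| + `|x - u|).
    by rewrite ler_wpM2l// -{1}[u](subKr x) ler_normB.
  lra.
pose K := g * e + (1 + e) * d.
(* This rests on [(1 + e)(1 - 2e) = 1 - e - 2e^2 <= 1 - e]. *)
have Kg : K < g.
  have : (1 + e) * d < (1 + e) * (g * (1 - 2 * e)).
    by rewrite ltr_pM2l//; lra.
  have : 0 <= g * (e * e) by rewrite !mulr_ge0// ltW.
  rewrite /K; nra.
(* Unlike [K], which may be 0, the midpoint [L] can be divided by, and it is still below [g]. *)
pose L := (K + g) / 2.
have K0 : 0 <= K by rewrite /K addr_ge0// mulr_ge0//; lra.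
have L0 : 0 < L by rewrite /L; lra.
have KL : K <= L by rewrite /L; lra.
exists ((g - L) / (1 + e)) => [|x].
  by rewrite divr_gt0// /L; lra.
rewrite mulrAC ler_pdivrMr; last lra.
(* In this form the claim bounds [|x - v|] from below for each null vector [v] of [S]; replacing [x]
   by [x - v] changes neither [S x] nor the distance. *)
suff : (g * dist x (nullspace S) - (1 + e) * `|S x|) / L <=
    dist x (nullspace S).
  by rewrite ler_pdivrMr//; lra.
apply: le_dist => [|v Sv]; first exact: linear_subspace_neq0.
rewrite ler_pdivrMr// mulrC.
have xv : dist x (nullspace S) = dist (x - v) (nullspace S).
  rewrite distD_mem//; rewrite -sub0r; apply: linear_subspaceB => //; exact: sS.1.
have Sxv : S x = S (x - v) by rewrite linearB/= Sv subr0.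
rewrite xv Sxv; move: (x - v) => z {xv Sxv Sv v x}.
have Tz : `|T z| <= `|S z| + `|dT z|.
  by rewrite -[T z](addrK (dT z)) -SE ler_normB.
have := distS z; rewrite -(ler_pM2l g0) => Dz.
have : (1 + e) * (g * dist z (nullspace T)) <= (1 + e) * (`|S z| + d * `|z|).
  rewrite ler_wpM2l//; first lra.
  by have := gT z; have := dTd z; lra.
have : K * `|z| <= L * `|z| by rewrite ler_wpM2r.
by rewrite /K; lra.
Qed.

Theorem theorem3p8 (R : realType) (X Y : completeNormedModType R)
  (reflX : reflexive_space X) (scX : strictly_convex X)
  (reflY : reflexive_space Y) (scY : strictly_convex Y)
  (T dT : {linear X -> Y})
  (bT : bounded_operator T) (bdT : bounded_operator dT)
  (closedT : closed (range T))
  (small_dT :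
    ((reduced_min_modulus T)^-1 * (opnorm dT)%:E < 1)%E)
  (small_gap :
    ((gap (nullspace T) (nullspace (T \+ dT)))%:E <
      (2^-1)%:E * (1 - (reduced_min_modulus T)^-1 * (opnorm dT)%:E))%E) :
  MP_metric_inverse_exists (T \+ dT).
Proof.
pose S : {linear X -> Y} := T \+ dT.
rewrite -/(MP_metric_inverse_exists S).
have bS : bounded_operator S.
  have [M TM] := bT; have [K dTK] := bdT; exists (M + K) => x.
  by rewrite mulrDl (le_trans (ler_normD _ _))// lerD.
have sN := linear_subspace_nullspace S.
set e := gap _ _ in small_gap.
have e0 : 0 <= e by exact: gap_ge0.
have d0 := opnorm_ge0 bdT.
(* A positive lower bound for the modulus makes its inverse a genuine one. *)
have [c0 c00 c0T] := closed_range_bounded_below reflX reflY bT closedT.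
have c0rmm := le_reduced_min_modulus c0T.
have [g [g0 gT dg]] : exists g : R, [/\ 0 < g,
    (g%:E <= reduced_min_modulus T)%E & opnorm dT < g * (1 - 2 * e)].
  case: (reduced_min_modulus T) c0rmm small_gap => [r c0r|_|//].
    have r0 : 0 < r by rewrite (lt_le_trans c00)// -lee_fin.
    rewrite inver gt_eqF// => er.
    have {}er : e < 2^-1 * (1 - r^-1 * opnorm dT).
      by rewrite -lte_fin EFinM EFinB EFinM.
    exists r; split=> //.
    have : r * (2 * e) < r * (1 - r^-1 * opnorm dT) by rewrite ltr_pM2l//; lra.
    by rewrite mulrBr mulVKf ?gt_eqF//; lra.
  rewrite invey mul0e sube0 mule1 lte_fin => e2.
  have e2' : 0 < 1 - 2 * e by lra.
  (* Here the modulus is [+oo] and any real [g] is below it; this one is large enough for the strict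
     inequality. *)
  exists (opnorm dT / (1 - 2 * e) + 1); split.
  - by rewrite ltr_wpDl// divr_ge0// ltW.
  - exact: leey.
  - by rewrite mulrDl divfK ?gt_eqF// mul1r ltrDl.
have [|x|x|u Tu|c cgt0 cS] := @perturbation_bounded_below _ _ _ T dT S g
  (opnorm dT) e _ _ _ _ g0 d0 e0 dg.
- by [].
- exact: reduced_min_modulus_bounded_below.
- exact: le_opnorm.
- by apply: gap_le => //; exact: linear_subspace_nullspace.
apply: (MP_metric_inverse_bounded_below _ _ cgt0 cS).
  by apply: chebyshev_reflexive => // x; exact: nullspace_dist0.
apply: chebyshev_reflexive => //; first exact: linear_subspace_range.
by move=> y; exact: bounded_below_range_closed cS.
Qed.
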